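(* Let $\mathcal{X}$ be a finite set with at least two elements, $(q_x)_{x\in\mathcal{X}}$ a probability distribution, $|\psi_x\rangle$ ($x\in\mathcal{X}$) unit vectors in a finite-dimensional Hilbert space $\mathcal{E}$, and $$\rho_{XE}=\sum_{x\in\mathcal{X}}q_x|x\rangle\langle x|\otimes|\psi_x\rangle\langle\psi_x|,\qquad \delta=\max_{x,y\in\mathcal{X}:\,x\neq y}|\langle\psi_x|\psi_y\rangle|.$$ If $\delta>0$, then for every $\epsilon\ge0$, $$1-\epsilon/2\le(1-\delta)\,p^{\epsilon}_{\downarrow}(X|E)_\rho+\delta.$$
   Context: $\|K\|_{tr}=\mathrm{Tr}\sqrt{K^\dagger K}$ (no factor $1/2$). A cc state is $\eta_{XY}=\sum_{x,y}p_{x,y}|x\rangle\langle x|\otimes|y\rangle\langle y|$ with $(p_{x,y})$ a probability distribution on $\mathcal{X}\times\mathcal{Y}$, $\mathcal{Y}$ finite; its guessing probability is $p_g(X|Y)_\eta=\sum_y\max_xp_{x,y}$. The $\epsilon$-smooth conversion parameter of a normalized classical-quantum state $\rho_{XE}$ is $$p^{\epsilon}_{\downarrow}(X|E)_\rho=\min\{p_g(X|Y)_\eta:\ \|(\mathcal{I}\otimes\mathcal{C})(\eta_{XY})-\rho_{XE}\|_{tr}\le\epsilon\},$$ the minimum being over all cc states $\eta_{XY}$ (with $X$ register $\mathcal{X}$ and any finite $\mathcal{Y}$) and all quantum channels $\mathcal{C}$ from the $Y$ register to $\mathcal{E}$. *)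

(* Defs.v *)
From mathcomp Require Import all_boot all_order all_algebra.
From mathcomp Require Import complex mxtens.
From mathcomp Require Import all_classical all_reals.

Set Implicit Arguments.
Unset Strict Implicit.
Unset Printing Implicit Defensive.

Import Order.TTheory GRing.Theory Num.Theory.
Local Open Scope ring_scope.
Local Open Scope sesquilinear_scope.
Local Open Scope complex_scope.
Local Open Scope classical_set_scope.

(* Registers are coordinate spaces over R[i]: vectors are columns, operators are
   square matrices, [M ^t*] is the adjoint and [A *t B] the Kronecker product.
   A finite set T labels the basis of a #|T|-dimensional register through
   [enum_rank]. *)

Section LinearAlgebra.
Variable R : realType.
Local Notation C := R[i].

Definition braket d (u v : 'cV[C]_d) : C := (u ^t* *m v) 0 0.

Definition proj d (u : 'cV[C]_d) : 'M[C]_d := u *m u ^t*.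

Definition basis_proj (T : finType) (t : T) : 'M[C]_#|T| :=
  delta_mx (enum_rank t) (enum_rank t).

(* Over R[i], [0 <= z] says that z is real and nonnegative, so psd matrices are
   Hermitian. *)
Definition psd n (A : 'M[C]_n) : Prop :=
  forall v : 'cV[C]_n, 0 <= braket v (A *m v).

(* Spectral functional calculus, meaningful for psd A; see [abs_mx_sqr] and
   [abs_mx_psd]. *)
Definition sqrt_mx n (A : 'M[C]_n) : 'M[C]_n :=
  invmx (spectralmx A) *m diag_mx (map_mx sqrtC (spectral_diag A))
    *m spectralmx A.

Definition abs_mx n (K : 'M[C]_n) : 'M[C]_n := sqrt_mx (K ^t* *m K).

(* The trace of the psd matrix [abs_mx K] is real, so nothing is lost by taking
   the real part. *)
Definition trace_norm n (K : 'M[C]_n) : R := complex.Re (\tr (abs_mx K)).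

Lemma adj_mul m n p (A : 'M[C]_(m, n)) (B : 'M_(n, p)) :
  (A *m B) ^t* = B ^t* *m A ^t*.
Proof. by rewrite trmx_mul map_mxM. Qed.

Lemma braketE d (u : 'cV[C]_d) : braket u u = \sum_i `|u i 0| ^+ 2.
Proof. by rewrite /braket mxE; apply: eq_bigr => i _; rewrite !mxE normCKC. Qed.

Lemma adjmul_normal n (K : 'M[C]_n) : K ^t* *m K \is normalmx.
Proof. by apply/normalmxP; rewrite adj_mul trmxCK. Qed.

Lemma spectral_diag_ge0 n (K : 'M[C]_n) i : 0 <= spectral_diag (K ^t* *m K) 0 i.
Proof.
set A := K ^t* *m K; set P := spectralmx A.
have PU : P \is unitarymx := spectral_unitarymx A.
have /orthomx_spectralP AE := adjmul_normal K; rewrite -/A -/P in AE.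
have -> : spectral_diag A 0 i =
          braket (K *m P ^t* *m delta_mx i 0) (K *m P ^t* *m delta_mx i 0).
  have E : P *m A *m P ^t* = diag_mx (spectral_diag A).
    have /unitarymxP PP := PU.
    rewrite [X in P *m X]AE !mulmxA mulmxV ?spectral_unit // mul1mx.
    by rewrite -mulmxA PP mulmx1.
  set e : 'cV[C]_n := delta_mx i 0.
  have -> : braket (K *m P ^t* *m e) (K *m P ^t* *m e) =
            (e ^t* *m (P *m A *m P ^t* *m e)) 0 0.
    by rewrite /braket !adj_mul trmxCK /A !mulmxA.
  rewrite E.
  have -> : e ^t* = delta_mx 0 i.
    by apply/matrixP=> a b; rewrite !mxE conjC_nat andbC.
  by rewrite -rowE -colE !mxE eqxx mulr1n.
by rewrite braketE sumr_ge0 // => j _; rewrite exprn_ge0.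
Qed.

Lemma abs_mx_sqr n (K : 'M[C]_n) : abs_mx K *m abs_mx K = K ^t* *m K.
Proof.
have /orthomx_spectralP AE := adjmul_normal K; rewrite [RHS]AE.
rewrite /abs_mx /sqrt_mx !mulmxA mulmxK ?spectral_unit //; congr (_ *m _).
rewrite -mulmxA mulmx_diag; congr (_ *m diag_mx _).
by apply/rowP=> i; rewrite !mxE -expr2 sqrtCK.
Qed.

Lemma abs_mx_psd n (K : 'M[C]_n) : psd (abs_mx K).
Proof.
move=> v; rewrite /abs_mx /sqrt_mx /braket.
rewrite invmx_unitary ?spectral_unitarymx // !mulmxA -adj_mul -!mulmxA mxE.
apply: sumr_ge0 => j _; rewrite mul_diag_mx !mxE mulrCA mulr_ge0 //.
  by rewrite sqrtC_ge0 spectral_diag_ge0.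
by rewrite -normCKC exprn_ge0.
Qed.

End LinearAlgebra.

Section Channels.
Variable R : realType.
Local Notation C := R[i].

Definition tens_block k m (K : 'M[C]_(k * m)) (i j : 'I_k) : 'M[C]_m :=
  \matrix_(a, b) K (mxtens_index (i, a)) (mxtens_index (j, b)).

Definition id_tens k m d (Phi : 'M[C]_m -> 'M[C]_d) (K : 'M[C]_(k * m)) :
    'M[C]_(k * d) :=
  \sum_i \sum_j delta_mx i j *t Phi (tens_block K i j).

Lemma id_tens_tens k m d (Phi : {linear 'M[C]_m -> 'M[C]_d})
    (A : 'M[C]_k) (B : 'M[C]_m) : id_tens Phi (A *t B) = A *t Phi B.
Proof.
have blockE i j : tens_block (A *t B) i j = A i j *: B.
  by apply/matrixP=> a b; rewrite !mxE !mxtens_indexK.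
apply/matrixP=> r s; rewrite /id_tens summxE.
rewrite (bigD1 (mxtens_unindex r).1) //= [X in _ + X]big1 ?addr0; last first.
  move=> i /negPf ne; rewrite summxE big1 // => j _.
  by rewrite !mxE eq_sym ne mul0r.
rewrite summxE (bigD1 (mxtens_unindex s).1) //= [X in _ + X]big1 ?addr0.
  by rewrite blockE linearZ !mxE !eqxx mul1r.
by move=> j /negPf ne; rewrite !mxE [X in _ && X]eq_sym ne andbF mul0r.
Qed.

Definition completely_positive m d (Phi : 'M[C]_m -> 'M[C]_d) : Prop :=
  forall k (K : 'M[C]_(k * m)), psd K -> psd (id_tens Phi K).

Definition quantum_channel m d (Phi : {linear 'M[C]_m -> 'M[C]_d}) : Prop :=
  completely_positive Phi /\ forall A, \tr (Phi A) = \tr A.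

End Channels.

Section States.
Variable R : realType.
Local Notation C := R[i].

Definition distribution (T : finType) (p : T -> R) : Prop :=
  (forall t, 0 <= p t) /\ \sum_t p t = 1.

Definition cc_state (X Y : finType) (p : X * Y -> R) : 'M[C]_(#|X| * #|Y|) :=
  \sum_x \sum_y (p (x, y))%:C *: (basis_proj R x *t basis_proj R y).

Definition cq_state (X : finType) d (q : X -> R) (psi : X -> 'cV[C]_d) :
    'M[C]_(#|X| * d) :=
  \sum_x (q x)%:C *: (basis_proj R x *t proj (psi x)).

(* The maxima below are over nonnegative reals, hence the neutral element 0. *)
Definition guess_prob (X Y : finType) (p : X * Y -> R) : R :=
  \sum_y \big[Num.max/0]_x p (x, y).

Definition max_overlap (X : finType) d (psi : X -> 'cV[C]_d) : R :=
  \big[Num.max/0]_(xy : X * X | xy.1 != xy.2)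
     complex.Re `|braket (psi xy.1) (psi xy.2)|.

(* The infimum is that of a set bounded below by 0, and nonempty when rho is a
   normalized cq state and 0 <= eps (copy x to Y, then prepare the conditional
   state of E); it is the minimum whenever the latter is attained. *)
Definition smooth_conversion (X : finType) d (eps : R)
    (rho : 'M[C]_(#|X| * d)) : R :=
  inf [set g | exists (Y : finType) (p : X * Y -> R)
                 (Phi : {linear 'M[C]_#|Y| -> 'M[C]_d}),
        [/\ distribution p, quantum_channel Phi,
            trace_norm (id_tens Phi (cc_state p) - rho) <= eps
          & g = guess_prob p]].

End States.

(* Main.v *)
(** Write the channel output as sum_x |x><x| (x) sum_y p_xy sigma_y.  Testing it
    against the projector M = sum_x |x><x| (x) |psi_x><psi_x|, for which
    tr (M rho) = 1, and using tr (M D) <= tr |D| / 2 for D Hermitian and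
    traceless, gives 1 - eps/2 <= sum_y tr (A_y sigma_y), where
    A_y = sum_x p_xy |psi_x><psi_x|.  The nonzero spectrum of A_y is that of the
    Gram matrix of the vectors sqrt(p_xy) psi_x, whose diagonal is p_xy and whose
    off-diagonal entries are at most delta sqrt(p_xy p_x'y), so that
    A_y <= (1 - delta) max_x p_xy + delta sum_x p_xy.  Summing over y bounds every
    admissible guessing probability; the infimum ranges over a nonempty set
    because copying x and then preparing psi_x reproduces rho exactly. *)

Require Import Defs.
From HB Require Import structures.
From mathcomp Require Import all_boot all_order all_algebra.
From mathcomp Require Import complex mxtens ring lra.
From mathcomp Require Import all_classical all_reals.

Set Implicit Arguments.
Unset Strict Implicit.
Unset Printing Implicit Defensive.

Import Order.TTheory GRing.Theory Num.Theory.
Local Open Scope ring_scope.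
Local Open Scope sesquilinear_scope.
Local Open Scope complex_scope.

Local Notation proj := Defs.proj.

(** * Brackets, adjoints, positivity and the trace norm *)

Section Operators.
Context {R : realType}.
Local Notation C := R[i].
Implicit Types d m n : nat.

(* Instances of [rmorphM], etc., which unlike these survive [/=] as [Num.conj]
   instead of the concrete [conjc]. *)
Lemma conjM (a b : C) : Num.conj (a * b) = Num.conj a * Num.conj b.
Proof. exact: rmorphM. Qed.

Lemma conjD (a b : C) : Num.conj (a + b) = Num.conj a + Num.conj b.
Proof. exact: rmorphD. Qed.

Lemma conjN (a : C) : Num.conj (- a) = - Num.conj a.
Proof. exact: rmorphN. Qed.

Lemma conj_sum (I : finType) (F : I -> C) :
  Num.conj (\sum_i F i) = \sum_i Num.conj (F i).
Proof. exact: rmorph_sum. Qed.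

Lemma conj_real (r : R) : Num.conj (r%:C : C) = r%:C.
Proof. by apply/CrealP/complex_realP; exists r. Qed.

Lemma braketDr d (u v w : 'cV[C]_d) : braket u (v + w) = braket u v + braket u w.
Proof. by rewrite /braket mulmxDr mxE. Qed.

Lemma braketZr d a (u v : 'cV[C]_d) : braket u (a *: v) = a * braket u v.
Proof. by rewrite /braket -scalemxAr mxE. Qed.

Lemma braket_sumr d (I : finType) (u : 'cV[C]_d) (F : I -> 'cV[C]_d) :
  braket u (\sum_i F i) = \sum_i braket u (F i).
Proof. by rewrite /braket mulmx_sumr summxE. Qed.

Lemma braketC d (u v : 'cV[C]_d) : braket u v = Num.conj (braket v u).
Proof.
rewrite /braket !mxE conj_sum; apply: eq_bigr => i _.
by rewrite !mxE conjM conjCK mulrC.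
Qed.

Lemma braketDl d (u v w : 'cV[C]_d) : braket (u + v) w = braket u w + braket v w.
Proof. by rewrite braketC braketDr conjD -!braketC. Qed.

Lemma braketZl d a (u v : 'cV[C]_d) : braket (a *: u) v = Num.conj a * braket u v.
Proof. by rewrite braketC braketZr conjM -braketC. Qed.

Lemma braket_suml d (I : finType) (u : 'cV[C]_d) (F : I -> 'cV[C]_d) :
  braket (\sum_i F i) u = \sum_i braket (F i) u.
Proof.
rewrite braketC braket_sumr conj_sum.
by apply: eq_bigr => i _; rewrite -braketC.
Qed.

Lemma braket_mull m n (A : 'M[C]_(m, n)) u v :
  braket (A *m u) v = braket u (A ^t* *m v).
Proof. by rewrite /braket adj_mul mulmxA. Qed.

Lemma braket_ge0 d (u : 'cV[C]_d) : 0 <= braket u u.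
Proof. by rewrite braketE sumr_ge0 // => i _; rewrite exprn_ge0. Qed.

Lemma braket_eq0 d (u : 'cV[C]_d) : braket u u = 0 -> u = 0.
Proof.
move=> /eqP; rewrite braketE psumr_eq0; last by move=> i _; rewrite exprn_ge0.
move=> /allP u0; apply/colP => i; rewrite mxE; apply/eqP.
by have := u0 i (mem_index_enum i); rewrite sqrf_eq0 normr_eq0.
Qed.

Lemma proj_mul d (u v : 'cV[C]_d) : proj u *m v = braket u v *: u.
Proof.
rewrite /proj -mulmxA [u ^t* *m v]mx11_scalar.
by rewrite mul_mx_scalar.
Qed.

Lemma mxtrace_proj_mul d (u : 'cV[C]_d) (A : 'M[C]_d) :
  \tr (proj u *m A) = braket u (A *m u).
Proof.
by rewrite /proj -mulmxA mxtrace_mulC -mulmxA /mxtrace big_ord1.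
Qed.

Lemma mxtrace_proj d (u : 'cV[C]_d) : \tr (proj u) = braket u u.
Proof. by rewrite -[proj u]mulmx1 mxtrace_proj_mul mul1mx. Qed.

Lemma proj_adj d (u : 'cV[C]_d) : (proj u) ^t* = proj u.
Proof. by rewrite adj_mul trmxCK. Qed.

Lemma proj_idem d (u : 'cV[C]_d) :
  braket u u = 1 -> proj u *m proj u = proj u.
Proof. by move=> u1; rewrite {2 3}/proj mulmxA proj_mul u1 scale1r. Qed.

Lemma adjD m n (A B : 'M[C]_(m, n)) : (A + B) ^t* = A ^t* + B ^t*.
Proof. by apply/matrixP => i j; rewrite !mxE conjD. Qed.

Lemma adjN m n (A : 'M[C]_(m, n)) : (- A) ^t* = - A ^t*.
Proof. by apply/matrixP => i j; rewrite !mxE conjN. Qed.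

Lemma adjZ m n a (A : 'M[C]_(m, n)) : (a *: A) ^t* = Num.conj a *: A ^t*.
Proof. by apply/matrixP => i j; rewrite !mxE conjM. Qed.

Lemma adj_sum m n (I : finType) (F : I -> 'M[C]_(m, n)) :
  (\sum_i F i) ^t* = \sum_i (F i) ^t*.
Proof.
apply/matrixP => i j; rewrite !mxE !summxE conj_sum.
by apply: eq_bigr => k _; rewrite !mxE.
Qed.

Lemma adj1 n : (1%:M : 'M[C]_n) ^t* = 1%:M.
Proof. by apply/matrixP => i j; rewrite !mxE eq_sym conjC_nat. Qed.

Lemma adj_delta m n i j : (delta_mx i j : 'M[C]_(m, n)) ^t* = delta_mx j i.
Proof. by apply/matrixP => a b; rewrite !mxE conjC_nat andbC. Qed.

Lemma adj_tens m n p q (A : 'M[C]_(m, n)) (B : 'M[C]_(p, q)) :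
  (A *t B) ^t* = A ^t* *t B ^t*.
Proof. by rewrite trmx_tens map_mxT. Qed.

Lemma mxtrace_sum n (I : finType) (F : I -> 'M[C]_n) :
  \tr (\sum_i F i) = \sum_i \tr (F i).
Proof. exact: raddf_sum. Qed.

Lemma mxtrace_tens m n (A : 'M[C]_m) (B : 'M[C]_n) :
  \tr (A *t B) = \tr A * \tr B.
Proof.
by rewrite /mxtrace mulr_sum; apply: eq_bigr => i _; rewrite mxE.
Qed.

(* Polarization: compare the real numbers <u+v|A|u+v> and <u+iv|A|u+iv>. *)
Lemma psd_adj n (A : 'M[C]_n) : psd A -> A ^t* = A.
Proof.
move=> psdA.
have real w : Num.conj (braket w (A *m w)) = braket w (A *m w).
  by apply/CrealP; rewrite ger0_real.
have sym u v : braket u (A *m v) = Num.conj (braket v (A *m u)).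
  have := real (u + v); have := real (u + 'i *: v).
  rewrite !mulmxDr -!scalemxAr !braketDl !braketDr !braketZl !braketZr.
  rewrite !conjD !conjM !real.
  set a := braket u (A *m v); set b := braket v (A *m u).
  rewrite !conjCK conjCi => E1 E2.
  (* The vector [u + 'i *: v] yields [Num.conj b - Num.conj a = a - b], and [u + v] yields
     [Num.conj a + Num.conj b = a + b]; adding the two gives [a = Num.conj b]. *)
  have F1 : 'i * (Num.conj b - Num.conj a) = 'i * (a - b) :> C.
    apply/eqP; rewrite -subr_eq0; move/eqP: E1; rewrite -subr_eq0 => /eqP <-.
    by apply/eqP; ring.
  have F2 := mulfI (neq0Ci C) F1.
  have F3 : Num.conj a + Num.conj b = a + b.
    by move: E2; rewrite !addrA => /addIr; rewrite -!addrA => /addrI.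
  have F4 : 2 * a = 2 * Num.conj b.
    have -> : 2 * Num.conj b =
        Num.conj b - Num.conj a + (Num.conj a + Num.conj b) by ring.
    by rewrite F2 F3; ring.
  by apply: mulfI F4; rewrite pnatr_eq0.
apply/matrixP => i j.
have entry (B : 'M[C]_n) k l : B k l = braket (delta_mx k 0) (B *m delta_mx l 0).
  by rewrite /braket adj_delta -colE -rowE !mxE.
by rewrite 2!mxE (entry A j i) (entry A i j) -sym.
Qed.

(** The vectors [w i] are the columns of the adjoint of the spectral unitary. Keeping the
    eigenvector equation beside the sum lets positivity be read off eigenvalue by eigenvalue. *)
Lemma spectral_decomposition n (A : 'M[C]_n) : A ^t* = A ->
  exists (a : 'I_n -> C) (w : 'I_n -> 'cV[C]_n),
    [/\ A = \sum_i a i *: proj (w i), forall i, braket (w i) (w i) = 1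
      & forall i, A *m w i = a i *: w i].
Proof.
move=> adjA; have /orthomx_spectralP : A \is normalmx.
  by apply/normalmxP; rewrite adjA.
set P := spectralmx A; set D := spectral_diag A.
rewrite invmx_unitary ?spectral_unitarymx // => AE.
have PP : P *m P ^t* = 1%:M by apply/unitarymxP/spectral_unitarymx.
pose w i : 'cV[C]_n := P ^t* *m delta_mx i 0.
have w1 i : braket (w i) (w i) = 1.
  rewrite braket_mull trmxCK mulmxA PP mul1mx.
  by rewrite /braket adj_delta mul_delta_mx mxE eqxx.
have Aw i : A *m w i = D 0 i *: w i.
  rewrite /w AE -!mulmxA (mulmxA P) PP mul1mx scalemxAr; congr (_ *m _).
  apply/colP => j; rewrite mul_diag_mx !mxE.
  by case: eqP => [->|]; rewrite ?mulr0.
exists (D 0), w; split=> //; rewrite [LHS]AE.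
have -> : diag_mx D = \sum_i D 0 i *: delta_mx i i.
  apply/matrixP => i j; rewrite summxE (bigD1 i) //= big1 => [|k /negPf ki].
    by rewrite !mxE eqxx addr0 eq_sym mulr_natr.
  by rewrite !mxE eq_sym ki mulr0.
rewrite mulmx_sumr mulmx_suml; apply: eq_bigr => i _.
rewrite -scalemxAr -scalemxAl /proj /w adj_mul trmxCK adj_delta.
by rewrite !mulmxA -(mulmxA _ (delta_mx i 0)) mul_delta_mx.
Qed.

Lemma psd_sum n (I : finType) (F : I -> 'M[C]_n) :
  (forall i, psd (F i)) -> psd (\sum_i F i).
Proof.
by move=> pF v; rewrite mulmx_suml braket_sumr sumr_ge0 // => i _; exact: pF.
Qed.

Lemma psdZ n a (A : 'M[C]_n) : 0 <= a -> psd A -> psd (a *: A).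
Proof. by move=> a0 pA v; rewrite -scalemxAl braketZr mulr_ge0. Qed.

Lemma psd_congr m n (V : 'M[C]_(n, m)) (A : 'M[C]_m) :
  psd A -> psd (V *m A *m V ^t*).
Proof.
by move=> pA v; rewrite -[V in V *m A]trmxCK -!mulmxA -braket_mull.
Qed.

Lemma psd1 n : psd (1%:M : 'M[C]_n).
Proof. by move=> v; rewrite mul1mx braket_ge0. Qed.

Lemma psd_proj n (u : 'cV[C]_n) : psd (proj u).
Proof. by rewrite /proj -[u in u *m _]mulmx1; apply: psd_congr; apply: psd1. Qed.

Lemma psd_idem n (A : 'M[C]_n) : A ^t* = A -> A *m A = A -> psd A.
Proof.
move=> adjA idA; rewrite -idA -[A in A *m _]mulmx1 -{2}adjA.
exact/psd_congr/psd1.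
Qed.

(** Each coefficient of the spectral decomposition is an eigenvalue with a unit, hence nonzero,
    eigenvector, and projectors are positive. *)
Lemma psd_eigen n (A : 'M[C]_n) : A ^t* = A ->
  (forall a (v : 'cV[C]_n), v != 0 -> A *m v = a *: v -> 0 <= a) -> psd A.
Proof.
move=> /spectral_decomposition[a [w [-> w1 Aw]]] ev.
apply: psd_sum => i; apply: psdZ; last exact: psd_proj.
apply: (ev _ (w i)) => //; apply/eqP => w0.
by have := w1 i; rewrite w0 /braket mulmx0 mxE => /esym/eqP; rewrite oner_eq0.
Qed.

(** Diagonalizing [A] turns the trace into a sum of eigenvalues of [A] times expectations of [B],
    all nonnegative. *)
Lemma mxtrace_psd_mul_ge0 n (A B : 'M[C]_n) :
  psd A -> psd B -> 0 <= \tr (A *m B).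
Proof.
move=> pA pB; have [a [w [AE w1 Aw]]] := spectral_decomposition (psd_adj pA).
rewrite AE mulmx_suml raddf_sum sumr_ge0 // => i _ /=.
rewrite -scalemxAl mxtraceZ mxtrace_proj_mul mulr_ge0 //.
by have := pA (w i); rewrite Aw braketZr w1 mulr1.
Qed.

(* An eigenvector v of A - B with eigenvalue a satisfies
   a (<v|A|v> + <v|B|v>) = 0 and a <v|v> = <v|A|v> - <v|B|v>. *)
Lemma psd_sub_of_sqr_eq n (A B : 'M[C]_n) :
  psd A -> B ^t* = B -> A *m A = B *m B -> psd (A - B).
Proof.
move=> pA adjB AB; have adjA := psd_adj pA.
apply: psd_eigen => [|a v v0 ev]; first by rewrite adjD adjN adjA adjB.
have vv : 0 < braket v v.
  by rewrite lt0r braket_ge0 andbT; apply/eqP => /braket_eq0/eqP; apply/negP.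
have ar : a * braket v v = braket v (A *m v) - braket v (B *m v).
  by rewrite -braketZr -ev mulmxBl -scaleN1r braketDr braketZr mulN1r.
have realB : Num.conj (braket v (B *m v)) = braket v (B *m v).
  by rewrite -braketC braket_mull adjB.
have E : a * (braket v (A *m v) + braket v (B *m v)) = 0.
  (* The operator is A^2 - B^2 = 0. Moving [A - B] onto the eigenvector [v] on either side produces
     the factors [a] and [Num.conj a], which agree because a <v|v> is real. *)
  have : braket v ((A *m (A - B) + (A - B) *m B) *m v) = 0.
    by rewrite mulmxBr mulmxBl AB addrA subrK subrr mul0mx /braket mulmx0 mxE.
  rewrite mulmxDl braketDr -!mulmxA ev -scalemxAr braketZr.
  have -> : braket v ((A - B) *m (B *m v)) = Num.conj a * braket v (B *m v).
    by rewrite -{1}adjB -{1}adjA -adjN -adjD -braket_mull ev braketZl.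
  have -> : Num.conj a = a; last by rewrite mulrDr.
  apply: (mulIf (lt0r_neq0 vv)); rewrite ar.
  rewrite -[in LHS](CrealP (ger0_real (ltW vv))) -conjM ar conjD conjN realB.
  by rewrite (CrealP (ger0_real (pA v))).
(* Either a = 0, or <v|B|v> = -<v|A|v>, and then a <v|v> = 2 <v|A|v> is nonnegative. *)
move: E => /eqP; rewrite mulf_eq0 => /orP[/eqP -> //|].
rewrite addrC addr_eq0 => /eqP BA.
by rewrite -(pmulr_lge0 _ vv) ar BA opprK addr_ge0.
Qed.

(** With A = |D|, both A - D and A + D are positive. Adding tr (M (A - D)) >= 0 and tr ((1 - M) (A +
    D)) >= 0 cancels tr (M A) and leaves tr A - 2 tr (M D) >= 0, since tr D = 0. *)
Lemma mxtrace_idem_le_trace_norm n (D M : 'M[C]_n) :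
  D ^t* = D -> \tr D = 0 -> M ^t* = M -> M *m M = M ->
  2 * complex.Re (\tr (M *m D)) <= trace_norm D.
Proof.
move=> hermD trD adjM idM; rewrite /trace_norm; set A := abs_mx D.
have pA : psd A := abs_mx_psd D.
have AD : A *m A = D *m D by rewrite abs_mx_sqr hermD.
have pos : psd (A - D) by apply: psd_sub_of_sqr_eq.
have neg : psd (A + D).
  rewrite -[D]opprK; apply: psd_sub_of_sqr_eq => //; first by rewrite adjN hermD.
  by rewrite mulNmx mulmxN opprK.
have pM : psd M by apply: psd_idem.
have pcM : psd (1%:M - M).
  apply: psd_idem; first by rewrite adjD adjN adj1 adjM.
  by rewrite mulmxBl mul1mx mulmxBr mulmx1 idM subrr subr0.
have := addr_ge0 (mxtrace_psd_mul_ge0 pM pos)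
                 (mxtrace_psd_mul_ge0 pcM neg).
rewrite mulmxBr mulmxBl mul1mx mulmxDr !raddfB !raddfD /= trD addr0.
rewrite lecE => /andP[_]; rewrite /= !(raddfB, raddfD) /=; lra.
Qed.

Lemma trace_normN n (K : 'M[C]_n) : trace_norm (- K) = trace_norm K.
Proof. by rewrite /trace_norm /abs_mx adjN mulNmx mulmxN opprK. Qed.

Lemma trace_norm0 n : trace_norm (0 : 'M[C]_n) = 0.
Proof.
rewrite /trace_norm; set A := abs_mx _.
have adjA : A ^t* = A := psd_adj (abs_mx_psd _).
suff -> : A = 0 by rewrite mxtrace0.
suff Av (v : 'cV[C]_n) : A *m v = 0.
  apply/matrixP => i j; have /colP/(_ i) := Av (delta_mx j 0).
  by rewrite -colE !mxE.
(* [A] is Hermitian with A^2 = 0, so the squared norm <v|A^2|v> of A v vanishes. *)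
apply: braket_eq0; rewrite braket_mull adjA mulmxA abs_mx_sqr.
by rewrite mulmx0 mul0mx /braket mulmx0 mxE.
Qed.

End Operators.

(** * Gram matrix bound for mixtures of nearly orthogonal pure states *)

Section Gram.
Context {R : realType}.
Local Notation C := R[i].

(** This bounds the quadratic form of the matrix with entries sqrt(p_x p_y) g_xy at the vector
    sqrt(p_x) t_x, written without square roots. The comparison is termwise: p_x <= m on the
    diagonal, 2 t_x t_y <= t_x^2 + t_y^2 off it. *)
Lemma weighted_gram_le (X : finType) (p t : X -> R) (g : X -> X -> R)
    (delta m : R) :
  (forall x, 0 <= p x <= m) -> (forall x, 0 <= t x) -> 0 <= delta <= 1 ->
  (forall x y, g x y <= if x == y then 1 else delta) ->
  \sum_x \sum_y p x * t x * (p y * t y) * g x y <=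
    ((1 - delta) * m + delta * \sum_x p x) * \sum_x p x * t x ^+ 2.
Proof.
move=> hp ht /andP[d0 d1] hg; set S := \sum_x p x * t x ^+ 2.
(* The right side becomes a double sum; its [delta] part is symmetrized in x and y to match the
   off-diagonal estimate. *)
have -> : ((1 - delta) * m + delta * \sum_x p x) * S =
    \sum_x \sum_y ((x == y)%:R * ((1 - delta) * m * (p x * t x ^+ 2)) +
      delta / 2 * (p x * t x ^+ 2 * p y + p x * (p y * t y ^+ 2))).
  have row x : \sum_y ((x == y)%:R * ((1 - delta) * m * (p x * t x ^+ 2)) +
      delta / 2 * (p x * t x ^+ 2 * p y + p x * (p y * t y ^+ 2))) =
      (1 - delta) * m * (p x * t x ^+ 2) +
      delta / 2 * (p x * t x ^+ 2 * \sum_y p y + p x * S).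
    rewrite big_split /= -!mulr_sumr big_split /= -!mulr_sumr; congr (_ + _).
    rewrite (bigD1 x) //= eqxx mul1r big1 ?addr0 // => y.
    by rewrite eq_sym => /negPf ->; rewrite mul0r.
  rewrite (eq_bigr _ (fun x _ => row x)) big_split /= -!mulr_sumr.
  rewrite big_split /= -!mulr_suml -/S; by field.
apply: ler_sum => x _; apply: ler_sum => y _.
have /andP[px0 pxm] := hp x; have /andP[py0 _] := hp y.
have tx := ht x; have ty := ht y.
have w0 : 0 <= p x * t x * (p y * t y) by rewrite !mulr_ge0.
apply: le_trans (ler_wpM2l w0 (hg x y)) _.
have pp : 0 <= p x * p y by rewrite mulr_ge0.
case: eqP => [<-|_].
  have : 0 <= (1 - delta) * (p x * t x ^+ 2) * (m - p x).
    by rewrite !mulr_ge0 ?subr_ge0 ?exprn_ge0.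
  rewrite mulr1n; lra.
have : 0 <= delta * (p x * p y) * (t x - t y) ^+ 2 
  by rewrite mulr_ge0 ?sqr_ge0 // mulr_ge0.
rewrite mulr0n mul0r; lra.
Qed.

Lemma Re_le_norm (z : C) : complex.Re z <= complex.Re `|z|.
Proof.
have := normc_ge_Re z; rewrite lecE => /andP[_]; apply: le_trans => /=.
exact: ler_norm.
Qed.

Lemma Re_normK (z : C) : (complex.Re `|z|)%:C = `|z|.
Proof. exact/RRe_real/normr_real. Qed.

Lemma Re_normM (z1 z2 : C) :
  complex.Re `|z1 * z2| = complex.Re `|z1| * complex.Re `|z2|.
Proof. by apply: complexI; rewrite rmorphM /= !Re_normK normrM. Qed.

Lemma Re_norm_ge0 (z : C) : 0 <= complex.Re `|z|.
Proof. by rewrite -ler0c Re_normK. Qed.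

Lemma Re_norm_ge0_real (r : R) : 0 <= r -> complex.Re `|r%:C| = r.
Proof. by move=> r0; rewrite ger0_norm ?ler0c. Qed.

(* With A the mixture, s = <v|A|v> and w = A v, the Gram matrix bounds give
   <w|w> <= c s, and then 0 <= <c v - w|c v - w> <= c (c <v|v> - s). *)
Lemma psd_scalar_sub_mixture (X : finType) d (psi : X -> 'cV[C]_d)
    (p : X -> R) (delta m : R) (c := (1 - delta) * m + delta * \sum_x p x) :
  (forall x, braket (psi x) (psi x) = 1) ->
  (forall x y, x != y -> complex.Re `|braket (psi x) (psi y)| <= delta) ->
  (forall x, 0 <= p x <= m) -> 0 < delta <= 1 -> 0 <= m ->
  psd (c%:C%:M - \sum_x (p x)%:C *: proj (psi x)).
Proof.
move=> psi1 overlap hp /andP[d0 d1] m0.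
have p0 x : 0 <= p x by case/andP: (hp x).
have P0 : 0 <= \sum_x p x by apply: sumr_ge0.
set A := \sum_x _; have pA : psd A.
  by apply: psd_sum => x; apply: psdZ (psd_proj _); rewrite ler0c.
have c0 : 0 <= c by rewrite addr_ge0 // mulr_ge0 ?subr_ge0 // ltW.
(* The main argument ends by cancelling a factor [c]. If [c] is 0, then [0 < delta] forces every
   [p x] to vanish, and the operator is 0. *)
case: (eqVneq c 0) => [cE0|cneq0].
  have : \sum_x p x = 0.
    have : 0 <= (1 - delta) * m by rewrite mulr_ge0 ?subr_ge0.
    have : 0 <= delta * \sum_x p x by rewrite mulr_ge0 // ltW.
    move: cE0; rewrite /c => ? ? ?.
    have : delta * \sum_x p x = 0 by lra.
    by move/eqP; rewrite mulf_eq0 gt_eqF //= => /eqP.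
  move=> /eqP; rewrite psumr_eq0 // => /allP pE0.
  rewrite cE0 /A big1 => [|x _]; last first.
    by have /eqP -> := pE0 x (mem_index_enum x); rewrite scale0r.
  by move=> v; rewrite subr0 mul_scalar_mx rmorph0 scale0r /braket mulmx0 mxE.
have {c0 cneq0} c0 : 0 < c by rewrite lt_def cneq0.
move=> v; pose b x := braket (psi x) v; pose t x := complex.Re `|b x|.
set w := A *m v.
have wE : w = \sum_x ((p x)%:C * b x) *: psi x.
  rewrite /w /A mulmx_suml; apply: eq_bigr => x _.
  by rewrite -scalemxAl proj_mul scalerA.
set S := \sum_x p x * t x ^+ 2.
have vw : braket v w = S%:C.
  rewrite wE braket_sumr rmorph_sum; apply: eq_bigr => x _ /=.
  rewrite braketZr -mulrA braketC -/(b x) -normCK -Re_normK.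
  by rewrite -rmorphXn -rmorphM.
have wv : braket w v = S%:C by rewrite braketC vw conj_real.
(* After expanding <w|w> over pairs, each term is bounded by its modulus, so that the Gram estimate
   applies with t_x = |<psi_x|v>|. *)
have ww : complex.Re (braket w w) <= c * S.
  rewrite {1}wE braket_suml raddf_sum.
  have overlap' x y : complex.Re `|braket (psi x) (psi y)| <=
      if x == y then 1 else delta.
    by case: eqP => [->|/eqP/overlap //]; rewrite psi1 normr1.
  have t0 x : 0 <= t x by apply: Re_norm_ge0.
  have d01 : 0 <= delta <= 1 by rewrite d1 ltW.
  apply: le_trans (weighted_gram_le hp t0 d01 overlap').
  apply: ler_sum => x _ /=; rewrite wE braket_sumr raddf_sum.
  apply: ler_sum => y _ /=; apply: le_trans (Re_le_norm _) _.
  rewrite braketZl braketZr !Re_normM norm_conjC !Re_normM.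
  by rewrite !Re_norm_ge0_real ?p0 // -[leRHS]mulrA.
have real_braket (u : 'cV[C]_d) : braket u u = (complex.Re (braket u u))%:C.
  by rewrite RRe_real // ger0_real // braket_ge0.
move: ww; set W := complex.Re _ => ww.
pose V := complex.Re (braket v v).
have := braket_ge0 (c%:C *: v + (-1) *: w).
rewrite !braketDl !braketDr !braketZl !braketZr vw wv
  (real_braket v) (real_braket w) -/V -/W.
rewrite mulmxBl mul_scalar_mx -/w -(scaleN1r w) braketDr !braketZr vw (real_braket v) -/V.
rewrite conj_real conjN conjC1.
(* The squared norm of c v - w is c times the target c V - S, minus the quantity c S - W, which [ww]
   makes nonnegative. *)
have -> : c%:C * (c%:C * V%:C) + c%:C * (-1 * S%:C) +
    (-1 * (c%:C * S%:C) + -1 * (-1 * W%:C)) =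
    (c * (c * V - S) - (c * S - W))%:C.
  by move: (S) (V) (W) (c) => *; ring.
have -> : c%:C * V%:C + -1 * S%:C = (c * V - S)%:C.
  by move: (S) (V) (c) => *; ring.
rewrite !ler0c => pos; rewrite -(pmulr_rge0 _ c0).
by apply: le_trans pos _; rewrite lerBlDr lerDl subr_ge0.
Qed.

End Gram.

(** * Kronecker products, complete positivity and block-diagonal operators *)

Section Tensors.
Context {R : realType}.
Local Notation C := R[i].

Lemma tensmxDr m n p q (A : 'M[C]_(m, n)) (B B' : 'M[C]_(p, q)) :
  A *t (B + B') = A *t B + A *t B'.
Proof. by apply/matrixP => i j; rewrite !mxE mulrDr. Qed.

Lemma tensmxZr m n p q a (A : 'M[C]_(m, n)) (B : 'M[C]_(p, q)) :
  A *t (a *: B) = a *: (A *t B).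
Proof. by apply/matrixP => i j; rewrite !mxE mulrCA. Qed.

Lemma tensmxNr m n p q (A : 'M[C]_(m, n)) (B : 'M[C]_(p, q)) :
  A *t (- B) = - (A *t B).
Proof. by apply/matrixP => i j; rewrite !mxE mulrN. Qed.

Lemma tensmx_sumr m n p q (I : finType) (A : 'M[C]_(m, n))
    (F : I -> 'M[C]_(p, q)) : A *t (\sum_i F i) = \sum_i A *t F i.
Proof.
apply/matrixP => i j; rewrite summxE mxE summxE mulr_sumr.
by apply: eq_bigr => k _; rewrite mxE.
Qed.

(** Tensoring with the 1 by 1 identity only changes the dimension from n to 1 * n; eliminating that
    equality removes the cast. *)
Lemma psd_of_tens1 n (B : 'M[C]_n) : psd ((1%:M : 'M_1) *t B) -> psd B.
Proof.
by rewrite tens_scalar_mx scale1r; case: _ / (esym (mul1n n)); rewrite castmx_id.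
Qed.

Lemma tens_block_sum k m (I : finType) (F : I -> 'M[C]_(k * m)) i j :
  tens_block (\sum_l F l) i j = \sum_l tens_block (F l) i j.
Proof.
apply/matrixP => a b; rewrite mxE !summxE.
by apply: eq_bigr => l _; rewrite mxE.
Qed.

Lemma tens_blockZ k m c (K : 'M[C]_(k * m)) i j :
  tens_block (c *: K) i j = c *: tens_block K i j.
Proof. by apply/matrixP => a b; rewrite !mxE. Qed.

Lemma sum_tens_block k m (K : 'M[C]_(k * m)) :
  K = \sum_i \sum_j delta_mx i j *t tens_block K i j.
Proof.
apply/matrixP => r s.
case: (mxtens_indexP r) => i a; case: (mxtens_indexP s) => j b.
rewrite summxE (bigD1 i) //= [X in _ + X]big1 ?addr0 => [|i' /negPf ne].
  rewrite summxE (bigD1 j) //= [X in _ + X]big1 ?addr0 => [|j' /negPf ne].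
    by rewrite tensmxE !mxE !eqxx mul1r.
  by rewrite tensmxE !mxE (eq_sym j) ne andbF mul0r.
by rewrite summxE big1 // => j' _; rewrite tensmxE !mxE (eq_sym i) ne mul0r.
Qed.

Lemma id_tens_sum k m d (Phi : {linear 'M[C]_m -> 'M[C]_d}) (I : finType)
    (F : I -> 'M[C]_(k * m)) :
  id_tens Phi (\sum_l F l) = \sum_l id_tens Phi (F l).
Proof.
rewrite /id_tens [RHS]exchange_big; apply: eq_bigr => i _.
rewrite [RHS]exchange_big; apply: eq_bigr => j _.
by rewrite tens_block_sum raddf_sum tensmx_sumr.
Qed.

Lemma id_tensZ k m d (Phi : {linear 'M[C]_m -> 'M[C]_d}) c (K : 'M[C]_(k * m)) :
  id_tens Phi (c *: K) = c *: id_tens Phi K.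
Proof.
rewrite /id_tens scaler_sumr; apply: eq_bigr => i _.
rewrite scaler_sumr; apply: eq_bigr => j _.
by rewrite tens_blockZ linearZ tensmxZr.
Qed.

(** The extended map has Kraus operators [1%:M *t V l], and congruences preserve positivity. *)
Lemma kraus_completely_positive m d (I : finType) (V : I -> 'M[C]_(d, m))
    (Phi : 'M[C]_m -> 'M[C]_d) :
  (forall A, Phi A = \sum_l V l *m A *m (V l) ^t*) -> completely_positive Phi.
Proof.
move=> PhiE k K pK; rewrite /id_tens.
suff -> : \sum_i \sum_j delta_mx i j *t Phi (tens_block K i j) =
    \sum_l (1%:M *t V l) *m K *m (1%:M *t V l) ^t*.
  by apply: psd_sum => l; apply: psd_congr.
have term l : (1%:M *t V l) *m K *m (1%:M *t V l) ^t* =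
    \sum_i \sum_j delta_mx i j *t (V l *m tens_block K i j *m (V l) ^t*).
  rewrite [K in LHS]sum_tens_block mulmx_sumr mulmx_suml; apply: eq_bigr => i _.
  rewrite mulmx_sumr mulmx_suml; apply: eq_bigr => j _.
  by rewrite adj_tens adj1 !tensmx_mul mul1mx mulmx1.
rewrite (eq_bigr _ (fun l _ => term l)) [RHS]exchange_big; apply: eq_bigr => i _.
rewrite [RHS]exchange_big; apply: eq_bigr => j _.
by rewrite PhiE tensmx_sumr.
Qed.

Lemma basis_proj_idem (T : finType) (t : T) :
  basis_proj R t *m basis_proj R t = basis_proj R t.
Proof. exact: mul_delta_mx. Qed.

Lemma basis_proj_neq (T : finType) (s t : T) :
  s != t -> basis_proj R s *m basis_proj R t = 0.
Proof. by move=> st; rewrite mul_delta_mx_0 // (inj_eq enum_rank_inj). Qed.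

Lemma basis_proj_adj (T : finType) (t : T) :
  (basis_proj R t) ^t* = basis_proj R t.
Proof. exact: adj_delta. Qed.

Lemma mxtrace_basis_proj (T : finType) (t : T) : \tr (basis_proj R t) = 1.
Proof.
rewrite /mxtrace (bigD1 (enum_rank t)) //= big1 ?addr0 ?mxE ?eqxx // => i.
by move=> /negPf ne; rewrite mxE ne.
Qed.

Lemma sum_basis_proj (T : finType) : \sum_(t : T) basis_proj R t = 1%:M.
Proof.
apply/matrixP => i j; rewrite summxE (bigD1 (enum_val i)) //= big1.
  by rewrite !mxE enum_valK eqxx addr0 eq_sym.
move=> t ne; rewrite mxE; case: eqP => // iE.
by rewrite iE enum_rankK eqxx in ne.
Qed.

(** Complete positivity with a one-dimensional ancilla is plain positivity. *)
Lemma channel_basis_psd m (Y : finType) (Phi : {linear 'M[C]_#|Y| -> 'M[C]_m}) y :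
  quantum_channel Phi -> psd (Phi (basis_proj R y)).
Proof.
move=> [cp _]; apply: psd_of_tens1; rewrite -id_tens_tens; apply: cp.
apply: psd_idem; first by rewrite adj_tens adj1 basis_proj_adj.
by rewrite tensmx_mul mul1mx basis_proj_idem.
Qed.

(** Common form of the channel output, of rho and of the test projector: products, adjoints and
    traces reduce to the blocks. *)
Definition cq_op (X : finType) d (B : X -> 'M[C]_d) : 'M[C]_(#|X| * d) :=
  \sum_x basis_proj R x *t B x.

Lemma cq_op_mul (X : finType) d (A B : X -> 'M[C]_d) :
  cq_op A *m cq_op B = cq_op (fun x => A x *m B x).
Proof.
rewrite /cq_op mulmx_suml; apply: eq_bigr => x _.
rewrite mulmx_sumr (bigD1 x) //= big1 ?addr0.
  by rewrite tensmx_mul basis_proj_idem.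
by move=> y ne; rewrite tensmx_mul basis_proj_neq ?tens0mx // eq_sym.
Qed.

Lemma cq_op_adj (X : finType) d (A : X -> 'M[C]_d) :
  (cq_op A) ^t* = cq_op (fun x => (A x) ^t*).
Proof.
by rewrite adj_sum; apply: eq_bigr => x _; rewrite adj_tens basis_proj_adj.
Qed.

Lemma mxtrace_cq_op (X : finType) d (A : X -> 'M[C]_d) :
  \tr (cq_op A) = \sum_x \tr (A x).
Proof.
rewrite /cq_op raddf_sum; apply: eq_bigr => x _ /=.
by rewrite mxtrace_tens mxtrace_basis_proj mul1r.
Qed.

Lemma cq_op_sub (X : finType) d (A B : X -> 'M[C]_d) :
  cq_op A - cq_op B = cq_op (fun x => A x - B x).
Proof.
rewrite /cq_op -sumrB; apply: eq_bigr => x _.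
by rewrite tensmxDr tensmxNr.
Qed.

Lemma cq_stateE (X : finType) d (q : X -> R) (psi : X -> 'cV[C]_d) :
  cq_state q psi = cq_op (fun x => (q x)%:C *: proj (psi x)).
Proof. by apply: eq_bigr => x _; rewrite tensmxZr. Qed.

Lemma id_tens_cc_state (X Y : finType) d (p : X * Y -> R)
    (Phi : {linear 'M[C]_#|Y| -> 'M[C]_d}) :
  id_tens Phi (cc_state p) =
  cq_op (fun x => \sum_y (p (x, y))%:C *: Phi (basis_proj R y)).
Proof.
rewrite /cc_state id_tens_sum; apply: eq_bigr => x _.
rewrite id_tens_sum tensmx_sumr; apply: eq_bigr => y _.
by rewrite id_tensZ id_tens_tens tensmxZr.
Qed.

End Tensors.

(** * The bound for a fixed cc state and channel *)

Section Bound.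
Context {R : realType} (X : finType) (d : nat).
Local Notation C := R[i].
Context (q : X -> R) (psi : X -> 'cV[C]_d) (q_distr : distribution q)
  (psi1 : forall x, braket (psi x) (psi x) = 1).
Local Notation delta := (max_overlap psi).

Lemma Re_realM (r : R) (z : C) : complex.Re (r%:C * z) = r * complex.Re z.
Proof. by case: z => a b /=; rewrite mul0r subr0. Qed.

Lemma overlap_le_max x y :
  x != y -> complex.Re `|braket (psi x) (psi y)| <= delta.
Proof.
move=> xy; exact: (@le_bigmax_cond _ _ _ _ (x, y) _
  (fun xy : X * X => complex.Re `|braket (psi xy.1) (psi xy.2)|)).
Qed.

(** Cauchy-Schwarz for unit vectors: with a = <psi_x|psi_y>, the squared norm of psi_y - a psi_x is
    1 - |a|^2. *)
Lemma max_overlap_le1 : delta <= 1.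
Proof.
apply: bigmax_le => // -[x y] _ /=.
set a := braket (psi x) (psi y).
have := braket_ge0 (psi y + (- a) *: psi x).
rewrite !braketDl !braketDr !braketZl !braketZr !psi1 -/a.
have -> : braket (psi y) (psi x) = Num.conj a by rewrite -braketC.
have r0 := Re_norm_ge0 a; set r := complex.Re `|a| in r0 *.
have aa : a * Num.conj a = (r ^+ 2)%:C by rewrite -normCK -Re_normK rmorphXn.
have -> : 1 + - a * Num.conj a + (Num.conj (- a) * a + Num.conj (- a) * (- a * 1)) =
    (1 - r ^+ 2)%:C.
  rewrite conjN rmorphB rmorph1 /= -aa; move: (a) (Num.conj a) => *; ring.
by rewrite ler0c subr_ge0 expr_le1.
Qed.

Lemma guess_prob_bound (Y : finType) (p : X * Y -> R)
    (Phi : {linear 'M[C]_#|Y| -> 'M[C]_d}) :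
  0 < delta -> distribution p -> quantum_channel Phi ->
  1 - trace_norm (id_tens Phi (cc_state p) - cq_state q psi) / 2 <=
    (1 - delta) * guess_prob p + delta.
Proof.
move=> d0 [p0 p1] chan; have [_ trPhi] := chan.
rewrite id_tens_cc_state cq_stateE cq_op_sub.
set D := cq_op _; pose M := cq_op (fun x => proj (psi x)).
have psdPhi y : psd (Phi (basis_proj R y)) by apply: channel_basis_psd.
have hermD : D ^t* = D.
  rewrite cq_op_adj; apply: eq_bigr => x _; congr (_ *t _).
  rewrite adjD adjN adj_sum adjZ proj_adj conj_real; congr (_ - _).
  by apply: eq_bigr => y _; rewrite adjZ psd_adj ?conj_real.
have sum_p : \sum_x \sum_y p (x, y) = 1.
  by rewrite pair_big /= -p1; apply: eq_bigr => -[].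
have trD : \tr D = 0.
  have trDx x : \tr (\sum_y (p (x, y))%:C *: Phi (basis_proj R y) -
      (q x)%:C *: proj (psi x)) = (\sum_y p (x, y) - q x)%:C.
    rewrite raddfB raddf_sum /= mxtraceZ mxtrace_proj psi1 mulr1.
    rewrite rmorphB rmorph_sum /=; congr (_ - _); apply: eq_bigr => y _.
    by rewrite mxtraceZ trPhi mxtrace_basis_proj mulr1.
  rewrite mxtrace_cq_op (eq_bigr _ (fun x _ => trDx x)) -rmorph_sum sumrB.
  by case: q_distr => _ ->; rewrite sum_p subrr rmorph0.
have adjM : M ^t* = M.
  by rewrite cq_op_adj; apply: eq_bigr => x _; rewrite proj_adj.
have idM : M *m M = M.
  by rewrite cq_op_mul; apply: eq_bigr => x _; rewrite proj_idem.
(* The trace norm inequality is applied to [- D], that is rho minus the channel output, because the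
   test accepts rho with certainty. *)
have adjND : (- D) ^t* = - D by rewrite adjN hermD.
have := mxtrace_idem_le_trace_norm adjND _ adjM idM.
rewrite trace_normN mulmxN !raddfN /= trD oppr0 => /(_ erefl).
(* The sum of [f] over all pairs is the probability that the test [M] accepts the channel output. *)
pose f y x := p (x, y) * complex.Re (braket (psi x) (Phi (basis_proj R y) *m psi x)).
have -> : - complex.Re (\tr (M *m D)) = 1 - \sum_y \sum_x f y x.
  have trMDx x : complex.Re (\tr (proj (psi x) *m
      (\sum_y (p (x, y))%:C *: Phi (basis_proj R y) -
        (q x)%:C *: proj (psi x)))) = \sum_y f y x - q x.
    rewrite mulmxBr mulmx_sumr !raddfB /=; congr (_ - _).
      rewrite mxtrace_sum raddf_sum; apply: eq_bigr => y _ /=.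
      by rewrite -scalemxAr mxtraceZ Re_realM mxtrace_proj_mul.
    by rewrite -scalemxAr proj_idem // mxtraceZ mxtrace_proj psi1 Re_realM mulr1.
  rewrite cq_op_mul mxtrace_cq_op raddf_sum (eq_bigr _ (fun x _ => trMDx x)).
  by rewrite sumrB exchange_big; case: q_distr => _ ->; rewrite opprB.
(* The operator bound on the mixture for [y] is traced against [Phi (basis_proj R y)], which is
   positive of trace 1. *)
have fy y : \sum_x f y x <=
    (1 - delta) * \big[Num.max/0]_x p (x, y) + delta * \sum_x p (x, y).
  set m := \big[Num.max/0]_x p (x, y).
  have m0 : 0 <= m by exact: bigmax_ge_id.
  have hp x : 0 <= p (x, y) <= m by rewrite p0 /=; apply: le_bigmax.
  have d01 : 0 < delta <= 1 by rewrite d0 max_overlap_le1.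
  have := mxtrace_psd_mul_ge0
    (psd_scalar_sub_mixture psi1 overlap_le_max hp d01 m0) (psdPhi y).
  rewrite mulmxBl mul_scalar_mx mulmx_suml raddfB /= mxtraceZ mxtrace_sum.
  rewrite trPhi mxtrace_basis_proj mulr1 lecE => /andP[_] /=.
  rewrite raddfB raddf_sum /= subr_ge0; apply: le_trans.
  apply: ler_sum => x _.
  by rewrite -scalemxAl mxtraceZ Re_realM mxtrace_proj_mul.
have : \sum_y \sum_x f y x <= (1 - delta) * guess_prob p + delta.
  apply: le_trans (ler_sum _ (fun y _ => fy y)) _.
  by rewrite big_split /= -!mulr_sumr exchange_big /= sum_p mulr1.
lra.
Qed.

End Bound.

(** * A channel that reproduces rho from a copy of x *)

Section Preparation.
Context {R : realType} (X : finType) (d : nat).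
Local Notation C := R[i].
Context (psi : X -> 'cV[C]_d).

Let V x : 'M[C]_(d, #|X|) := psi x *m delta_mx 0 (enum_rank x).

(** The measure-and-prepare map with Kraus operators |psi_x><x|. *)
Definition prepare (A : 'M[C]_#|X|) : 'M[C]_d :=
  \sum_x V x *m A *m (V x) ^t*.

Fact prepare_is_linear : linear prepare.
Proof.
move=> a A B; rewrite /prepare scaler_sumr -big_split; apply: eq_bigr => x _ /=.
by rewrite mulmxDr mulmxDl -scalemxAr -scalemxAl.
Qed.

HB.instance Definition _ := GRing.isLinear.Build C 'M[C]_#|X| 'M[C]_d _ prepare
  prepare_is_linear.

Lemma prepare_adjV_V x : (forall x, braket (psi x) (psi x) = 1) ->
  (V x) ^t* *m V x = basis_proj R x.
Proof.
move=> psi1; rewrite /V adj_mul adj_delta mulmxA -(mulmxA _ _ (psi x)).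
rewrite [_ ^t* *m psi x]mx11_scalar -/(braket _ _) psi1 mulmx1.
exact: mul_delta_mx.
Qed.

Lemma prepare_channel :
  (forall x, braket (psi x) (psi x) = 1) ->
  quantum_channel (prepare : {linear 'M[C]_#|X| -> 'M[C]_d}).
Proof.
move=> psi1; split; first exact: (@kraus_completely_positive _ _ _ _ V).
move=> A; rewrite /prepare /= raddf_sum /=.
(* By cyclicity each term is tr (A V_x^* V_x), and the products V_x^* V_x = |x><x| sum to the
   identity. *)
rewrite (eq_bigr (fun x => \tr (A *m basis_proj R x))) => [|x _]; last first.
  by rewrite mxtrace_mulC mulmxA -(prepare_adjV_V x psi1) mxtrace_mulC.
by rewrite -raddf_sum -mulmx_sumr sum_basis_proj mulmx1.
Qed.

Lemma prepare_basis_proj x : prepare (basis_proj R x) = proj (psi x).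
Proof.
have Vx y : V y *m basis_proj R x = if y == x then V x else 0.
  rewrite /V -mulmxA mul_delta_mx_cond (inj_eq enum_rank_inj).
  by case: eqP => [->|]; rewrite ?mulr1n // mulmx0.
rewrite /prepare (bigD1 x) //= big1 ?addr0 => [|y /negPf ne].
  rewrite Vx eqxx /V adj_mul adj_delta mulmxA -(mulmxA (psi x)) mul_delta_mx.
  have -> : delta_mx 0 0 = 1%:M :> 'M[C]_1.
    by apply/matrixP => i j; rewrite !ord1 !mxE.
  by rewrite mulmx1.
by rewrite Vx ne mul0mx.
Qed.

Lemma id_tens_prepare_copy (q : X -> R) :
  id_tens prepare (cc_state (fun xy : X * X => if xy.1 == xy.2 then q xy.1 else 0))
  = cq_state q psi.
Proof.
rewrite (id_tens_cc_state _ (prepare : {linear _ -> _})) cq_stateE.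
apply: eq_bigr => x _; congr (_ *t _).
rewrite (bigD1 x) //= big1 ?addr0 => [|y].
  by rewrite eqxx prepare_basis_proj.
by rewrite eq_sym => /negPf ->; rewrite scale0r.
Qed.

Lemma copy_distribution (q : X -> R) : distribution q ->
  distribution (fun xy : X * X => if xy.1 == xy.2 then q xy.1 else 0).
Proof.
move=> [q0 q1]; split=> [[x y]|]; first by case: ifP => /=.
rewrite -(pair_bigA _ (fun x y => if x == y then q x else 0)) /= -[RHS]q1.
apply: eq_bigr => x _.
by rewrite (bigD1 x) //= eqxx big1 ?addr0 // => y; rewrite eq_sym => /negPf ->.
Qed.

End Preparation.

Theorem lemma4p1 (R : realType) (X : finType) (d : nat)
    (q : X -> R) (psi : X -> 'cV[R[i]]_d) (eps : R)
    (hX : (2 <= #|X|)%N)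
    (hq : distribution q)
    (hpsi : forall x : X, braket (psi x) (psi x) = 1)
    (hdelta : 0 < max_overlap psi)
    (heps : 0 <= eps) :
  1 - eps / 2 <=
    (1 - max_overlap psi) * smooth_conversion eps (cq_state q psi)
    + max_overlap psi.
Proof.
set delta := max_overlap psi in hdelta *.
have d1 : delta <= 1 := max_overlap_le1 hpsi.
(* If [delta] is 1, the conversion parameter drops out and [heps] suffices; otherwise one may divide
   by 1 - [delta] and bound the infimum directly. *)
case: (eqVneq delta 1) => [->|dne1]; first by rewrite subrr mul0r add0r; lra.
have {d1 dne1} d1 : 0 < 1 - delta by rewrite subr_gt0 lt_neqAle dne1.
rewrite -lerBlDr -ler_pdivrMl // /smooth_conversion. apply: lb_le_inf.
  (* Nonemptiness of the set, needed because [inf] is a default value on the empty set; the copied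
     label gives distance 0, admissible by [heps]. *)
  eexists; exists X, (fun xy : X * X => if xy.1 == xy.2 then q xy.1 else 0),
    (prepare psi : {linear _ -> _}); split=> //.
  - exact: copy_distribution.
  - exact: prepare_channel.
  - by rewrite id_tens_prepare_copy subrr trace_norm0.
move=> _ [Y [p [Phi [hp chan tn ->]]]].
rewrite ler_pdivrMl // lerBlDr.
apply: le_trans (guess_prob_bound hq hpsi hdelta hp chan); lra.
Qed.
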